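(* Let $N\ge1$, $a_1,\ldots,a_N>0$ and $b_1,\ldots,b_{N-1}>0$, and let $w_1,\ldots,w_N$ be the associated spectral data of the pair $(L,M)$. Then $w_j>0$ for every $1\le j\le N$, and $\sum_{j=1}^N w_j=1$.
   Context: $L$ is the $N\times N$ upper bidiagonal matrix with $L_{n,n}=a_n$, $L_{n,n+1}=1$, all other entries $0$; $M$ is the $N\times N$ lower bidiagonal matrix with $M_{n,n}=1$, $M_{n+1,n}=-b_n$, all other entries $0$. The generalized eigenvalue problem $L\vec x=\lambda M\vec x$ has $N$ distinct positive eigenvalues (the zeros of $\det(zM-L)$), denoted $0<\lambda_1<\cdots<\lambda_N$. For each $j$ let $\vec v_j$ and $\vec u_j$ be the right and left eigenvectors, $L\vec v_j=\lambda_j M\vec v_j$ and $\vec u_j^{\,T}L=\lambda_j\vec u_j^{\,T}M$, both normalized to have first component equal to $1$ (always possible). Then $\vec u_j^{\,T}M\vec v_j\ne 0$ and $w_j=(\vec u_j^{\,T}M\vec v_j)^{-1}$. *)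

(* Defs.v *)
From HB Require Import structures.
From mathcomp Require Import all_boot all_order all_algebra.
Set Implicit Arguments.
Unset Strict Implicit.
Unset Printing Implicit Defensive.
Import Order.TTheory GRing.Theory Num.Theory.
Local Open Scope ring_scope.

(* Throughout N = n.+1, and indices are shifted down by one: a_1, ..., a_N is
   a : 'I_n.+1 -> R and b_1, ..., b_{N-1} is b : 'I_n -> R. *)

Definition Lmx (R : rcfType) (n : nat) (a : 'I_n.+1 -> R) : 'M[R]_n.+1 :=
  \matrix_(i, j) (if j == i then a i else if j == i.+1 :> nat then 1 else 0).

(* For k : 'I_n, lift ord0 k and widen_ord _ k are the elements k + 1 and k of
   'I_n.+1, so delta_mx has its 1 at the subdiagonal position (k + 1, k). *)
Definition Mmx (R : rcfType) (n : nat) (b : 'I_n -> R) : 'M[R]_n.+1 :=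
  1%:M - \sum_(k < n) b k *: delta_mx (lift ord0 k) (widen_ord (leqnSn n) k).

Definition gen_eigenvalue (R : rcfType) (n : nat) (L M : 'M[R]_n) (z : R) :
    Prop :=
  exists2 x : 'cV[R]_n, x != 0 & L *m x = z *: (M *m x).

(* The strict monotonicity and the last clause determine lam from L and M. *)
Definition ordered_gen_eigenvalues (R : rcfType) (n : nat) (L M : 'M[R]_n)
    (lam : 'I_n -> R) : Prop :=
  [/\ forall j, 0 < lam j,
      forall i j : 'I_n, (i < j)%N -> lam i < lam j
    & forall z, gen_eigenvalue L M z <-> exists j, z = lam j].

Definition normalized_right_eigenvector (R : rcfType) (n : nat)
    (L M : 'M[R]_n.+1) (z : R) (v : 'cV[R]_n.+1) : Prop :=
  L *m v = z *: (M *m v) /\ v ord0 ord0 = 1.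

Definition normalized_left_eigenvector (R : rcfType) (n : nat)
    (L M : 'M[R]_n.+1) (z : R) (u : 'cV[R]_n.+1) : Prop :=
  u^T *m L = z *: (u^T *m M) /\ u ord0 ord0 = 1.

Definition spectral_weight (R : rcfType) (n : nat) (M : 'M[R]_n)
    (u v : 'cV[R]_n) : R :=
  ((u^T *m M *m v) ord0 ord0)^-1.

(* Main.v *)
(* Let D be the diagonal matrix with d_i = \prod_(k < i) (z b_k)^-1.  Off the
   diagonal z D M and - (D L)^T agree, so
     z D M + (D L)^T = E,  E diagonal with entries d_i (z + a_i) > 0.
   Hence D (z M - L) is symmetric, and if v is the normalized right eigenvector
   for z then D v is the left one, u.  Evaluating the quadratic form of E at v
   gives v^T E v = z u^T M v + u^T L v = 2 z u^T M v, so u^T M v > 0.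
   As the eigenvalues are distinct, U^T M V = diag (1 / w_j), whence
   M (V W U^T) = 1; since the first row of M is that of the identity, the
   top left entry of this equation reads \sum_j w_j = 1. *)
Require Import Defs.
From HB Require Import structures.
From mathcomp Require Import all_boot all_order all_algebra.
Set Implicit Arguments.
Unset Strict Implicit.
Unset Printing Implicit Defensive.
Import Order.TTheory GRing.Theory Num.Theory.
Local Open Scope ring_scope.

(** Row [m] of [A *m y = 0] involves only the entries of [y] up to index [m + 1], the last with a
    nonzero coefficient, so the entries vanish one after another. *)
Lemma hessenberg_ker_eq0 (R : idomainType) (n : nat) (A : 'M[R]_n.+1)
    (y : 'cV[R]_n.+1) :
  (forall i j : 'I_n.+1, (i.+1 < j)%N -> A i j = 0) ->
  (forall i j : 'I_n.+1, j = i.+1 :> nat -> A i j != 0) ->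
  A *m y = 0 -> y ord0 ord0 = 0 -> y = 0.
Proof.
move=> A0 A1 Ay y0.
suff H m : forall i : 'I_n.+1, (i <= m)%N -> y i ord0 = 0.
  by apply/matrixP=> i j; rewrite ord1 mxE (H i).
elim: m => [|m IHm] i.
  by rewrite leqn0 => /eqP i0; rewrite (_ : i = ord0) //; apply: val_inj.
rewrite leq_eqVlt => /orP[/eqP im|]; last by rewrite ltnS; exact: IHm.
have mn : (m < n.+1)%N by rewrite ltnW // -im.
have /matrixP/(_ (Ordinal mn) ord0) := Ay.
rewrite !mxE (bigD1 i) //= big1 ?addr0 => [/eqP|j ji].
  by rewrite mulf_eq0 (negPf (A1 _ _ _)) //= => /eqP.
have [jm|mj] := leqP j m; first by rewrite IHm ?mulr0.
rewrite A0 ?mul0r //= ltn_neqAle mj andbT -im eq_sym.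
by apply: contra ji => /eqP/val_inj->.
Qed.

Section Pencil.
Variables (R : rcfType) (n : nat) (a : 'I_n.+1 -> R) (b : 'I_n -> R).
Hypotheses (a_gt0 : forall i, 0 < a i) (b_gt0 : forall i, 0 < b i).

Lemma MmxE (i j : 'I_n.+1) : Mmx b i j =
  (i == j)%:R -
    \sum_(k < n) b k * ((i == k.+1 :> nat) && (j == k :> nat))%:R.
Proof.
rewrite !mxE summxE; congr (_ - _); apply: eq_bigr => k _.
by rewrite !mxE -!val_eqE /= /bump leq0n add1n.
Qed.

Lemma Mmx_upper (i j : 'I_n.+1) : (i <= j)%N -> Mmx b i j = (i == j)%:R.
Proof.
move=> ij; rewrite MmxE big1 ?subr0 // => k _.
case: eqP => [ik|]; last by rewrite mulr0.
case: eqP => [jk|]; last by rewrite mulr0.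
by rewrite ik jk ltnn in ij.
Qed.

Definition symm_weight (z : R) (i : 'I_n.+1) : R :=
  \prod_(k < n | (k < i)%N) (z * b k)^-1.

Local Notation d := symm_weight.

Lemma symm_weight_gt0 (z : R) i : 0 < z -> 0 < d z i.
Proof. by move=> z0; apply: prodr_gt0 => k _; rewrite invr_gt0 mulr_gt0. Qed.

Lemma symm_weightS (z : R) (k : 'I_n) (i j : 'I_n.+1) : 0 < z ->
  i = k.+1 :> nat -> j = k :> nat -> z * d z i * b k = d z j.
Proof.
move=> z0 ik jk; rewrite /symm_weight (bigD1 k) /= ?ik // mulrAC mulrA.
rewrite divff ?gt_eqF ?mulr_gt0 // mul1r; apply: eq_bigl => l.
by rewrite jk ltnS ltn_neqAle andbC.
Qed.

(** Above the diagonal both terms vanish. Below it only [i = j + 1] matters: the terms are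
    [- z d_i b_j] and [d_j], which cancel by the recurrence defining the weights. *)
Lemma symm_weight_entry (z : R) (i j : 'I_n.+1) : 0 < z ->
  z * (d z i * Mmx b i j) + d z j * Lmx a j i =
    (d z i * (z + a i)) *+ (i == j).
Proof.
move=> z0; have [ij|ji] := leqP i j.
  rewrite Mmx_upper // mxE; case: eqP => [->|nij].
    by rewrite mulr1 mulr1n mulrDr [z * _]mulrC.
  rewrite !mulr0 mulr0n; case: eqP => [ij1|]; last by rewrite mulr0 addr0.
  by rewrite ij1 ltnn in ij.
have ijF : (i == j) = false by rewrite -val_eqE gtn_eqF.
rewrite MmxE mxE !ijF mulr0n.
case: eqP => [ij1|nij1].
  have kn : (j < n)%N by rewrite -ltnS -ij1.
  rewrite (bigD1 (Ordinal kn)) //= ij1 !eqxx mulr1 big1 => [|k]; last first.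
    by rewrite -val_eqE /= [(j == k :> nat)]eq_sym => /negPf->;
       rewrite andbF mulr0.
  rewrite addr0 sub0r !mulrN mulr1 mulrA.
  by rewrite (@symm_weightS z (Ordinal kn) i j) // addNr.
rewrite big1 => [|k _]; first by rewrite subr0 !mulr0 addr0.
case: eqP => [ik|]; last by rewrite mulr0.
by case: eqP => [jk|]; rewrite ?mulr0 //; case: nij1; rewrite ik jk.
Qed.

Let D z : 'M[R]_n.+1 := diag_mx (\row_i d z i).
Let E z : 'M[R]_n.+1 := diag_mx (\row_i (d z i * (z + a i))).

Lemma pencil_symm (z : R) : 0 < z ->
  z *: (D z *m Mmx b) + (D z *m Lmx a)^T = E z.
Proof.
move=> z0; apply/matrixP => i j.
by rewrite !mul_diag_mx !mxE -symm_weight_entry // !mxE.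
Qed.

(** Substituting [z D M = E - (D L)^T] gives [D (z M - L) = E - (D L)^T - D L], which is visibly
    symmetric. *)
Lemma pencil_trmx (z : R) : 0 < z ->
  D z *m (z *: Mmx b - Lmx a) = (z *: Mmx b - Lmx a)^T *m D z.
Proof.
move=> z0; have DT : (D z)^T = D z by rewrite tr_diag_mx.
have ET : (E z)^T = E z by rewrite tr_diag_mx.
have EK : z *: (D z *m Mmx b) = E z - (D z *m Lmx a)^T.
  by rewrite -pencil_symm // addrK.
rewrite -[in RHS]DT -trmx_mul mulmxBr -scalemxAr EK !linearB /= trmxK ET.
by rewrite addrAC.
Qed.

(** As [M] is lower triangular, [L - z M] is lower Hessenberg with ones on the superdiagonal. The
    difference of the two vectors lies in its kernel and starts with 0. *)
Lemma right_eigenvector_uniq (z : R) x y :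
  normalized_right_eigenvector (Lmx a) (Mmx b) z x ->
  normalized_right_eigenvector (Lmx a) (Mmx b) z y -> x = y.
Proof.
move=> [Lx x0] [Ly y0]; apply/eqP; rewrite -subr_eq0; apply/eqP.
have A (i j : 'I_n.+1) : (i < j)%N ->
    (Lmx a - z *: Mmx b) i j = (j == i.+1 :> nat)%:R.
  move=> ij; transitivity (Lmx a i j - z * Mmx b i j).
    by rewrite [LHS]mxE; congr (_ + _); rewrite [LHS]mxE [in LHS]mxE.
  rewrite Mmx_upper ?(ltnW ij) // mxE -!val_eqE /= (gtn_eqF ij) (ltn_eqF ij).
  by rewrite mulr0 subr0; case: (_ == _).
apply: (@hessenberg_ker_eq0 _ _ (Lmx a - z *: Mmx b)).
- by move=> i j ij; rewrite A ?(gtn_eqF ij) // ltnW.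
- by move=> i j ij; rewrite A ?ij // eqxx oner_neq0.
- by rewrite mulmxBl !mulmxBr Lx Ly !scalemxAl subrr.
- by rewrite !mxE x0 y0 subrr.
Qed.

Lemma left_eigenvectorE (z : R) u v : 0 < z ->
  normalized_right_eigenvector (Lmx a) (Mmx b) z v ->
  normalized_left_eigenvector (Lmx a) (Mmx b) z u -> u = D z *m v.
Proof.
move=> z0 vP [uL u0].
(* The candidate [D^-1 u]: symmetry makes it a right eigenvector, and [d_0 = 1], an empty product,
   keeps the normalization; uniqueness then identifies it with [v]. *)
pose y : 'cV[R]_n.+1 := \col_i ((d z i)^-1 * u i ord0).
have Dy : D z *m y = u.
  apply/matrixP => i j; rewrite mul_diag_mx !mxE (ord1 j) mulVKf //.
  by rewrite gt_eqF ?symm_weight_gt0.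
rewrite -Dy (@right_eigenvector_uniq z y v) //; split; last first.
  by rewrite mxE u0 mulr1 /symm_weight big_pred0 ?invr1.
have Dunit : D z \in unitmx.
  rewrite unitmxE det_diag unitfE; apply/prodf_neq0 => i _.
  by rewrite mxE gt_eqF ?symm_weight_gt0.
apply/eqP; rewrite eq_sym -subr_eq0 scalemxAl -mulmxBl; apply/eqP.
apply: (can_inj (mulKmx Dunit)); rewrite mulmx0 mulmxA pencil_trmx //.
rewrite -mulmxA Dy -[u]trmxK -trmx_mul mulmxBr uL -scalemxAr subrr.
by rewrite trmx0.
Qed.

Lemma spectral_weight_gt0 (z : R) u v : 0 < z ->
  normalized_right_eigenvector (Lmx a) (Mmx b) z v ->
  normalized_left_eigenvector (Lmx a) (Mmx b) z u ->
  0 < spectral_weight (Mmx b) u v.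
Proof.
move=> z0 vP uP; rewrite /spectral_weight invr_gt0.
have uE := left_eigenvectorE z0 vP uP.
have uT : u^T = v^T *m D z by rewrite uE trmx_mul tr_diag_mx.
(* A 1 x 1 matrix equals its transpose, which moves the transpose off [D L]. *)
have vL : v^T *m (D z *m Lmx a)^T *m v = u^T *m Lmx a *m v.
  have scalarT (A : 'M[R]_1) : A^T = A.
    by apply/matrixP => i j; rewrite mxE !ord1.
  by rewrite uT -[LHS]scalarT trmx_mul (trmx_mul v^T) !trmxK !mulmxA.
have vE : v^T *m E z *m v = (z *+ 2) *: (u^T *m Mmx b *m v).
  rewrite -pencil_symm // mulmxDr mulmxDl vL uP.1 -scalemxAr mulmxA -uT.
  by rewrite -!scalemxAl -scalerDl.
suff : 0 < (z *+ 2) * (u^T *m Mmx b *m v) ord0 ord0.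
  by rewrite pmulr_rgt0 // pmulrn_lgt0.
rewrite (_ : _ * _ = (v^T *m E z *m v) ord0 ord0); last by rewrite vE [RHS]mxE.
(* The term of index 0 is strictly positive because [v] has first entry 1; the others are weighted
   squares. *)
rewrite mul_mx_diag mxE big_ord_recl ltr_pwDl //.
  rewrite !mxE vP.2 mul1r mulr1 mulr_gt0 ?symm_weight_gt0 //.
  by rewrite addr_gt0.
apply: sumr_ge0 => i _; rewrite !mxE mulrAC mulr_ge0 //.
  by rewrite -expr2 sqr_ge0.
by rewrite mulr_ge0 ?ltW ?symm_weight_gt0 // addr_gt0.
Qed.

End Pencil.

(** Computing [u^T L v] from the left and from the right gives [(x - y) u^T M v = 0]. *)
Lemma gen_eigenvectors_orthogonal (F : fieldType) (n : nat) (L M : 'M[F]_n)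
    (x y : F) (u v : 'cV[F]_n) :
  u^T *m L = x *: (u^T *m M) -> L *m v = y *: (M *m v) -> x != y ->
  u^T *m M *m v = 0.
Proof.
move=> uL Lv xy; have : (x - y) *: (u^T *m M *m v) = 0.
  by rewrite scalerBl scalemxAl -uL -(mulmxA _ L) Lv -scalemxAr mulmxA subrr.
by move/eqP; rewrite scaler_eq0 subr_eq0 (negPf xy) => /eqP.
Qed.

Theorem corollary2p6 (R : rcfType) (n : nat)
    (a : 'I_n.+1 -> R) (b : 'I_n -> R)
    (a_gt0 : forall i, 0 < a i) (b_gt0 : forall i, 0 < b i)
    (lam : 'I_n.+1 -> R)
    (lamP : ordered_gen_eigenvalues (Lmx a) (Mmx b) lam)
    (u v : 'I_n.+1 -> 'cV[R]_n.+1)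
    (vP : forall j, normalized_right_eigenvector (Lmx a) (Mmx b) (lam j) (v j))
    (uP : forall j, normalized_left_eigenvector (Lmx a) (Mmx b) (lam j) (u j))
    (w : 'I_n.+1 -> R)
    (wE : forall j, w j = spectral_weight (Mmx b) (u j) (v j)) :
  (forall j, 0 < w j) /\ \sum_(j < n.+1) w j = 1.
Proof.
have [lam_gt0 lam_lt _] := lamP.
have w_gt0 j : 0 < w j.
  by rewrite wE; apply: (spectral_weight_gt0 a_gt0 b_gt0 (lam_gt0 j)).
split=> //.
have lam_neq i j : i != j -> lam i != lam j.
  rewrite -val_eqE neq_ltn => /orP[] /lam_lt; first by move/lt_eqF->.
  by move/gt_eqF->.
pose V : 'M[R]_n.+1 := \matrix_(i, j) v j i ord0.
pose W : 'M[R]_n.+1 := \matrix_(i, j) (w i * u i j ord0).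
have WMV : W *m (Mmx b *m V) = 1%:M.
  apply/matrixP => i j; rewrite mulmxA mxE.
  transitivity (w i * ((u i)^T *m Mmx b *m v j) ord0 ord0).
    rewrite mxE mulr_sumr; apply: eq_bigr => k _.
    rewrite !mxE mulrA mulr_sumr; congr (_ * _).
    by apply: eq_bigr => l _; rewrite !mxE mulrA.
  rewrite [RHS]mxE; have [<-|ij] := eqVneq i j.
    (* Since the inverse of 0 is 0 here, positivity of [w i] forces [u_i^T M v_i] to be nonzero, so
       that the product is 1. *)
    have := w_gt0 i; rewrite wE /spectral_weight invr_gt0 => q_gt0.
    by rewrite mulVf // gt_eqF.
  rewrite (gen_eigenvectors_orthogonal (uP i).1 (vP j).1 (lam_neq _ _ ij)).
  by rewrite mxE mulr0.
(* For square matrices a left inverse is also a right inverse, hence [M V W = 1]. In the top left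
   entry only [M_00 = 1] survives from the first row of [M], and the first entries of all [u_j] and
   [v_j] are 1. *)
have /matrixP/(_ ord0 ord0) := mulmx1C WMV.
rewrite -mulmxA mxE (bigD1 ord0) //= big1 => [|j j0]; last first.
  by rewrite Mmx_upper // eq_sym (negPf j0) mul0r.
rewrite Mmx_upper // eqxx mul1r addr0 !mxE eqxx => VW1; rewrite -[RHS]VW1.
by apply: eq_bigr => j _; rewrite !mxE (vP j).2 (uP j).2 mul1r mulr1.
Qed.
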